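(* Let $A$ be a Noetherian local ring with maximal ideal $\mathfrak{m}$ and $d = \dim A \geq 2$. Assume that $A$ is unmixed, that is, $\dim \widehat{A}/\mathfrak{p} = d$ for all $\mathfrak{p} \in \operatorname{Ass} \widehat{A}$. Then $A$ contains infinitely many parameter ideals $Q$ for which the equality $I^2 = QI$ holds true, where $I = Q : \mathfrak{m}$.
   Context: $\widehat{A}$ denotes the $\mathfrak{m}$-adic completion of $A$. A parameter ideal in $A$ is an ideal generated by a system of parameters of $A$. $Q:\mathfrak{m} = \{x\in A \mid x\mathfrak{m}\subseteq Q\}$. *)

(* Defs.v *)
(* Noetherian local rings, parameter ideals and the adic completion, on top of
   MathComp ([comNzRingType], [idealr], [prime_idealr], [{ideal_quot I}]) with
   the classical sets of MathComp-Analysis.  Arbitrary, possibly improper,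
   ideals are classical sets satisfying [is_ideal]; proper and prime ideals are
   MathComp's boolean ones, which loses no generality classically. *)
From HB Require Import structures.
From mathcomp Require Import all_boot all_algebra.
From mathcomp Require Import ring_quotient.
From mathcomp Require Import boolp classical_sets functions cardinality.

Set Implicit Arguments.
Unset Strict Implicit.
Unset Printing Implicit Defensive.

Import GRing.Theory.
Local Open Scope classical_set_scope.
Local Open Scope ring_scope.

Section Ideals.
Variable R : comNzRingType.
Implicit Types (I J Q : set R) (n d : nat).

Definition is_ideal J :=
  J 0 /\ forall a x y : R, J x -> J y -> J (a * x + y).

Definition ideal_span (s : seq R) : set R :=
  [set x | exists c : 'I_(size s) -> R, x = \sum_(i < size s) c i * s`_i].

Definition noetherian := forall J, is_ideal J -> exists s, J = ideal_span s.

Definition ideal_mul I J : set R :=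
  [set x | exists s : seq (R * R),
     (forall p, p \in s -> I p.1 /\ J p.2) /\ x = \sum_(p <- s) p.1 * p.2].

Definition ideal_pow J n : set R := iter n (ideal_mul J) setT.

Definition colon Q J : set R := [set x | forall y, J y -> Q (x * y)].

Definition radical Q : set R := [set x | exists n, Q (x ^+ n)].

Definition primary_ideal Q :=
  [/\ is_ideal Q, ~ Q 1
    & forall x y, Q (x * y) -> Q x \/ exists n, Q (y ^+ n)].

Definition maximal_ideal (m : idealr R) :=
  forall J, is_ideal J -> [set` m] `<=` J -> J = [set` m] \/ J = setT.

Definition local_ring (m : idealr R) :=
  maximal_ideal m /\
  forall m' : idealr R, maximal_ideal m' -> [set` m'] = [set` m].

Definition associated_prime (p : prime_idealr R) :=
  exists x : R, [set` p] = [set a | a * x = 0].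

(* Only the values c 0, ..., c n matter. *)
Definition prime_chain n (c : nat -> prime_idealr R) :=
  forall i, (i < n)%N -> [set` c i] `<` [set` c i.+1].

End Ideals.

(* The Krull dimension of R is finite and equal to d. *)
Definition krull_dim_eq (R : comNzRingType) (d : nat) :=
  (exists c : nat -> prime_idealr R, prime_chain d c) /\
  (forall n (c : nat -> prime_idealr R), prime_chain n c -> (n <= d)%N).

(* A system of parameters of a local ring of dimension d is a sequence of d
   elements generating an ideal that is primary to the maximal ideal. *)
Definition parameter_ideal (A : comNzRingType) (m : idealr A) (Q : set A) :=
  exists d (x : d.-tuple A),
    [/\ krull_dim_eq A d, primary_ideal (ideal_span x),
        radical (ideal_span x) = [set` m] & Q = ideal_span x].

(* The completion is the ring of Cauchy sequences of the I-adic topology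
   modulo the ideal of null sequences. *)
Section Completion.
Variables (A : comNzRingType) (I : idealr A).
Local Notation Ipow := (ideal_pow [set` I]).

Definition cauchy_seq (u : nat -> A) :=
  forall k, exists N, forall i j, (N <= i)%N -> (N <= j)%N -> Ipow k (u i - u j).

Definition null_seq (u : nat -> A) :=
  forall k, exists N, forall i, (N <= i)%N -> Ipow k (u i).

Definition cauchy_pred : {pred (nat -> A)} := fun u => `[< cauchy_seq u >].

Lemma ideal_pow_linear k a x y : Ipow k x -> Ipow k y -> Ipow k (a * x + y).
Proof.
case: k => //= k [s [sI ->]] [t [tI ->]].
exists ([seq (a * p.1, p.2) | p <- s] ++ t); split.
  move=> p; rewrite mem_cat => /orP[/mapP[q /sI[q1 q2] ->]|/tI //] /=.
  by split=> //; exact: idealMr.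
by rewrite big_cat big_map mulr_sumr /=; under eq_bigr do rewrite mulrA.
Qed.

Lemma ideal_pow0 k : Ipow k 0.
Proof. by case: k => //= k; exists [::]; split=> //; rewrite big_nil. Qed.

Lemma ideal_powD k x y : Ipow k x -> Ipow k y -> Ipow k (x + y).
Proof. by move=> hx hy; rewrite -[x]mul1r; exact: ideal_pow_linear. Qed.

Lemma ideal_powM k a x : Ipow k x -> Ipow k (a * x).
Proof.
by move=> hx; rewrite -[a * x]addr0; apply: ideal_pow_linear (ideal_pow0 k).
Qed.

Lemma ideal_powB k x y : Ipow k x -> Ipow k y -> Ipow k (x - y).
Proof.
by move=> hx hy; rewrite addrC -mulN1r; exact: ideal_pow_linear.
Qed.

Lemma cauchy_subring : subring_closed cauchy_pred.
Proof.
split.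
- apply/asboolP => k; exists 0%N => i j _ _.
  by rewrite (_ : _ - _ = 0) ?subrr //; exact: ideal_pow0.
- move=> u v /asboolP cu /asboolP cv; apply/asboolP => k.
  have [M hM] := cu k; have [N hN] := cv k.
  exists (maxn M N) => i j; rewrite !geq_max => /andP[Mi Ni] /andP[Mj Nj].
  rewrite (_ : _ - _ = (u i - u j) - (v i - v j)).
    by apply: ideal_powB; [exact: hM | exact: hN].
  rewrite -[LHS]/((u i - v i) - (u j - v j)) !opprB addrACA.
  by rewrite [- v i - u j]addrC -addrACA.
- move=> u v /asboolP cu /asboolP cv; apply/asboolP => k.
  have [M hM] := cu k; have [N hN] := cv k.
  exists (maxn M N) => i j; rewrite !geq_max => /andP[Mi Ni] /andP[Mj Nj].
  rewrite (_ : _ - _ = u i * (v i - v j) + v j * (u i - u j)).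
    by apply: ideal_powD; apply: ideal_powM; [exact: hN | exact: hM].
  rewrite -[LHS]/(u i * v i - u j * v j).
  by rewrite !mulrBr addrA [v j * u i]mulrC subrK [v j * u j]mulrC.
Qed.

HB.instance Definition _ :=
  GRing.isSubringClosed.Build (nat -> A) cauchy_pred cauchy_subring.

Record cauchy_ring := CauchySeq {
  cauchy_val :> nat -> A;
  cauchy_valP : cauchy_val \in cauchy_pred }.

HB.instance Definition _ := [isSub for cauchy_val].
HB.instance Definition _ := [Choice of cauchy_ring by <:].
HB.instance Definition _ :=
  [SubChoice_isSubComNzRing of cauchy_ring by <:].

Definition null_ideal : {pred cauchy_ring} := fun u => `[< null_seq u >].

Lemma null_idealr : idealr_closed null_ideal.
Proof.
split.
- by apply/asboolP => k; exists 0%N => i _; exact: ideal_pow0.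
- apply/negP => /asboolP /(_ 1%N) [N /(_ N (leqnn N))] /= [s [sI]] /= e1.
  suff: 1 \in I by rewrite idealr1.
  change (1 = \sum_(p <- s) p.1 * p.2) in e1; rewrite e1 big_seq.
  apply: rpred_sum => p /sI[] /= p1 _; rewrite mulrC; exact: idealMr.
- move=> a u v /asboolP hu /asboolP hv; apply/asboolP => k.
  have [M hM] := hu k; have [N hN] := hv k.
  exists (maxn M N) => i; rewrite geq_max => /andP[Mi Ni].
  by apply: ideal_pow_linear; [exact: hM | exact: hN].
Qed.

HB.instance Definition _ := isIdealr.Build cauchy_ring null_ideal null_idealr.

Definition completion : comNzRingType := {ideal_quot null_ideal}.

End Completion.

(* dim Ahat/p = d for every associated prime p of the m-adic completion Ahat. *)
Definition unmixed (A : comNzRingType) (m : idealr A) (d : nat) :=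
  forall p : prime_idealr (completion m),
    associated_prime p -> krull_dim_eq {ideal_quot p} d.

(* Main.v *)
(** Let [q_i = (b_0, ..., b_(i-1))] with [b_i = a_i ^+ (k_i + 2)] and
    [V_i = q_i : m^oo], where each [a_i] in [m] is regular modulo [V_i] and
    [k_i] is so large that [a_i ^+ k_i * V_i] lies in [q_i]; the [a_i] exist by
    avoiding the maximal annihilators modulo [V_i]. Put [Q = q_d] and
    [I = Q : m]. Splitting off one [a_i] at a time gives three facts:
    - [Q^2 `&` q_i = q_i Q];
    - [(Q + V_i) : m = I + V_i];
    - [m I `<=` m Q].
    Indeed for the last one, the only obstruction is that [m] be principal
    modulo some proper [V_i], and this is excluded: for [i = 0] by [d >= 2], for
    [i > 0] because [q_i] is generated by proper powers.
    By the last fact, every [x] in [I^2] satisfies [x m `<=` Q^2]. If moreover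
    [x = s + b_i p] with [s] in [q_i], then the first fact gives [p m `<=` Q + V_i],
    and the second one lets [b_i p] be replaced by an element of [Q I] modulo
    [q_i]; descending to [q_0 = 0] one gets [I^2 = Q I].
    A chain of primes below a prime containing [Q] shows that [Q] is primary
    to [m]. As [Q] can be found inside any ideal primary to [m], such as
    [m Q'] for a previous [Q'], there are infinitely many of them. *)

Require Import Defs.
From HB Require Import structures.
From mathcomp Require Import all_boot all_algebra ring_quotient.
From mathcomp Require Import boolp classical_sets functions cardinality.
From mathcomp Require Import ring.

Local Open Scope classical_set_scope.

Set Implicit Arguments.
Unset Strict Implicit.
Unset Printing Implicit Defensive.

Import GRing.Theory.
Local Open Scope ring_scope.

(** * Ideals as sets, maximal members of families of ideals, Nakayama's lemma at a prime *)

Section IdealTheory.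
Variable R : comNzRingType.
Implicit Types (I J K P : set R) (a b c u x y z : R).

Lemma ideal_closed0 J : is_ideal J -> J 0.
Proof. by case. Qed.

Lemma ideal_closedD J x y : is_ideal J -> J x -> J y -> J (x + y).
Proof. by case=> _ J1 Jx Jy; rewrite -[x]mul1r; exact: J1. Qed.

Lemma ideal_closedM J a x : is_ideal J -> J x -> J (a * x).
Proof. by case=> J0 J1 Jx; rewrite -[a * x]addr0; exact: J1. Qed.

Lemma ideal_closedMr J a x : is_ideal J -> J x -> J (x * a).
Proof. by rewrite mulrC; exact: ideal_closedM. Qed.

Lemma ideal_closedB J x y : is_ideal J -> J x -> J y -> J (x - y).
Proof.
by move=> iJ Jx Jy; rewrite -mulN1r; apply: ideal_closedD => //;
  apply: ideal_closedM.
Qed.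

Lemma ideal_closedBr J x y : is_ideal J -> J x -> J (x - y) -> J y.
Proof.
by move=> iJ Jx Jxy; rewrite (_ : y = x - (x - y)); [exact: ideal_closedB | ring].
Qed.

Lemma ideal_closed_sum J (T : eqType) (s : seq T) (F : T -> R) :
  is_ideal J -> (forall t, t \in s -> J (F t)) -> J (\sum_(t <- s) F t).
Proof.
move=> iJ JF; rewrite big_seq; elim/big_ind: _ => //.
  exact: ideal_closed0.
by move=> x y; exact: ideal_closedD.
Qed.

Lemma ideal_mem (m : idealr R) : is_ideal [set` m].
Proof.
split=> [|a x y mx my] /=; first exact: idealr0.
by apply: rpredD => //; exact: idealMr.
Qed.

Lemma ideal_zero : is_ideal [set 0 : R].
Proof. by split=> // a x y -> ->; rewrite /= mulr0 addr0. Qed.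

Lemma ideal_colon J K : is_ideal J -> is_ideal (colon J K).
Proof.
move=> iJ; split=> [y _|a x y Jx Jy z Kz]; first by rewrite mul0r; exact: ideal_closed0.
rewrite mulrDl -mulrA; apply: ideal_closedD => //; last exact: Jy.
by apply: ideal_closedM => //; exact: Jx.
Qed.

Lemma ideal_annihilator J c : is_ideal J -> is_ideal [set x | J (c * x)].
Proof.
move=> iJ; split=> [|a x y /= Jx Jy]; first by rewrite /= mulr0; exact: ideal_closed0.
rewrite (_ : c * _ = a * (c * x) + c * y); last by ring.
by apply: ideal_closedD => //; exact: ideal_closedM.
Qed.

Lemma ideal_mul_mem I J x y : I x -> J y -> ideal_mul I J (x * y).
Proof.
move=> Ix Jy; exists [:: (x, y)]; split; last by rewrite big_seq1.
by move=> p; rewrite inE => /eqP ->.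
Qed.

Lemma ideal_mul_min I J K : is_ideal K ->
  (forall x y, I x -> J y -> K (x * y)) -> ideal_mul I J `<=` K.
Proof.
move=> iK IJK x [s [sIJ ->]]; apply: ideal_closed_sum => // p /sIJ[Ip Jp].
exact: IJK.
Qed.

Lemma ideal_mul_ideal I J : is_ideal I -> is_ideal (ideal_mul I J).
Proof.
move=> iI; split=> [|a x y [s [sIJ ->]] [t [tIJ ->]]].
  by exists [::]; split=> //; rewrite big_nil.
exists ([seq (a * p.1, p.2) | p <- s] ++ t); split.
  move=> p; rewrite mem_cat => /orP[/mapP[r /sIJ[r1 r2] ->]|/tIJ //].
  by split=> //=; exact: ideal_closedM.
by rewrite big_cat big_map mulr_sumr /=; under eq_bigr do rewrite mulrA.
Qed.

Definition adjoin J c : set R := [set x | exists y z, J y /\ x = y + c * z].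

Lemma adjoin_ideal J c : is_ideal J -> is_ideal (adjoin J c).
Proof.
move=> iJ; split=> [|a _ _ [x [z [Jx ->]]] [y [w [Jy ->]]]].
  by exists 0, 0; split; [exact: ideal_closed0 | rewrite mulr0 addr0].
exists (a * x + y), (a * z + w); split; last by ring.
by apply: ideal_closedD => //; exact: ideal_closedM.
Qed.

Lemma sub_adjoin J c : J `<=` adjoin J c.
Proof. by move=> x Jx; exists x, 0; rewrite mulr0 addr0. Qed.

Lemma adjoin_mem J c : is_ideal J -> adjoin J c c.
Proof. by move=> /ideal_closed0 J0; exists 0, 1; rewrite mulr1 add0r. Qed.

Lemma adjoin_min J K c : is_ideal K -> J `<=` K -> K c -> adjoin J c `<=` K.
Proof.
move=> iK JK Kc _ [x [z [Jx ->]]]; apply: ideal_closedD => //; first exact: JK.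
exact: ideal_closedMr.
Qed.

Lemma adjoin_mul J K c x : is_ideal J -> is_ideal K ->
  ideal_mul (adjoin J c) K x ->
  exists s z, [/\ ideal_mul J K s, K z & x = s + c * z].
Proof.
move=> iJ iK; have iJK := ideal_mul_ideal K iJ.
apply: (@ideal_mul_min _ _
  [set x | exists s z, [/\ ideal_mul J K s, K z & x = s + c * z]]).
  split=> [|a _ _ [s [z [Js Kz ->]]] [t [w [Jt Kw ->]]]].
    exists 0, 0; split; [exact: ideal_closed0 | exact: ideal_closed0|].
    by rewrite mulr0 addr0.
  exists (a * s + t), (a * z + w); split; last by ring.
    by apply: ideal_closedD => //; exact: ideal_closedM.
  by apply: ideal_closedD => //; exact: ideal_closedM.
move=> _ y [s [z [Js ->]]] Ky; exists (s * y), (z * y); split; last by ring.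
  exact: ideal_mul_mem.
exact: ideal_closedM.
Qed.

Lemma ideal_span_ideal (s : seq R) : is_ideal (ideal_span s).
Proof.
split=> [|a _ _ [c ->] [e ->]].
  by exists (fun=> 0); rewrite big1 // => i _; rewrite mul0r.
exists (fun i => a * c i + e i); rewrite mulr_sumr -big_split /=.
by apply: eq_bigr => i _; rewrite mulrDl mulrA.
Qed.

Lemma ideal_span_mem (s : seq R) x : x \in s -> ideal_span s x.
Proof.
move=> /[dup] xs; rewrite -index_mem => lt_xs.
exists (fun i => (i == Ordinal lt_xs)%:R).
rewrite (bigD1 (Ordinal lt_xs)) //= eqxx mul1r nth_index //.
by rewrite big1 ?addr0 // => i /negPf ->; rewrite mul0r.
Qed.

Lemma ideal_span_min (s : seq R) J : is_ideal J ->
  (forall x, x \in s -> J x) -> ideal_span s `<=` J.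
Proof.
move=> iJ sJ _ [c ->]; apply: ideal_closed_sum => // i _.
by apply: ideal_closedM => //; apply: sJ; exact: mem_nth.
Qed.

Lemma idealr_closed_asbool P : is_ideal P -> ~ P 1 ->
  idealr_closed (fun x => `[< P x >]).
Proof.
move=> iP P1; split; first by apply/asboolP; exact: ideal_closed0.
  by apply/negP => /asboolP.
by move=> a x y /asboolP Px /asboolP Py; apply/asboolP; apply: iP.2.
Qed.

Lemma exists_idealr P : is_ideal P -> ~ P 1 ->
  exists p : idealr R, [set` p] = P.
Proof.
move=> iP P1; pose S : {pred R} := fun x => `[< P x >].
pose h := isIdealr.Build R S (idealr_closed_asbool iP P1).
pose p : idealr R := HB.pack S h.
by exists p; apply/seteqP; split=> x /asboolP.
Qed.

Lemma exists_prime_idealr P : is_ideal P -> ~ P 1 ->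
  (forall x y, P (x * y) -> P x \/ P y) ->
  exists p : prime_idealr R, [set` p] = P.
Proof.
move=> iP P1 prP; pose S : {pred R} := fun x => `[< P x >].
have prS : prime_idealr_closed S.
  by move=> x y /asboolP /prP[] Pxy; apply/orP; [left|right]; apply/asboolP.
pose h := isIdealr.Build R S (idealr_closed_asbool iP P1).
pose h' := isPrimeIdealrClosed.Build R S prS.
pose p : prime_idealr R := HB.pack S h h'.
by exists p; apply/seteqP; split=> x /asboolP.
Qed.

Lemma prime_mem_pow (p : prime_idealr R) x n : x ^+ n \in p -> x \in p.
Proof.
elim: n => [|n IHn]; first by rewrite expr0 idealr1.
by rewrite exprS prime_idealrM => /orP[//|/IHn].
Qed.

(** Without a maximal member, choice would give a strictly ascending chain in [F]. Its union is a
    finitely generated ideal, so the chain stops at a stage holding all generators. *)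
Lemma noetherian_max (F : set R -> Prop) : noetherian R ->
  (forall J, F J -> is_ideal J) -> (exists J, F J) ->
  exists2 J, F J & forall K, F K -> J `<=` K -> K `<=` J.
Proof.
move=> noeR idF [J0 FJ0]; apply: contrapT => nomax.
have step J : exists K, F J -> [/\ F K, J `<=` K & ~ K `<=` J].
  have [FJ|nFJ] := pselect (F J); last by exists J.
  apply: contrapT => noK; apply: nomax; exists J => // K FK JK.
  by apply: contrapT => nKJ; apply: noK; exists K.
have [f fP] := choice step; pose G n := iter n f J0.
have FG n : F (G n) by elim: n => //= n /fP[].
have Gmono n p : (n <= p)%N -> G n `<=` G p.
  move=> /subnK <-; elim: (p - n)%N => //= e IHe x /IHe.
  by have [_ + _] := fP _ (FG (e + n)%N); exact.
pose U : set R := [set x | exists n, G n x].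
have iU : is_ideal U.
  split=> [|a x y [n Gx] [p Gy]]; first by exists 0%N; exact: ideal_closed0 (idF _ FJ0).
  exists (maxn n p); apply: (idF _ (FG _)).2.
    by apply: Gmono Gx; exact: leq_maxl.
  by apply: Gmono Gy; exact: leq_maxr.
have [s Us] := noeR _ iU.
have [N sN] : exists N, forall x, x \in s -> G N x.
  have sU x : x \in s -> U x by rewrite Us; exact: ideal_span_mem.
  elim: (s) sU => [|y t IHt] sU; first by exists 0%N.
  have [x xt|N tN] := IHt; first by apply: sU; rewrite inE xt orbT.
  have [|n Gy] := sU y; first by rewrite mem_head.
  exists (maxn n N) => x; rewrite inE => /orP[/eqP ->|/tN].
    by apply: Gmono Gy; exact: leq_maxl.
  by apply: Gmono; exact: leq_maxr.
have [_ _ []] := fP _ (FG N) => x Gx.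
apply: (ideal_span_min (idF _ (FG N)) sN); rewrite -Us.
by exists N.+1.
Qed.

(** The ideals [J : u^n] increase with [n], so a maximal one contains all the others. *)
Lemma noetherian_pow_colon J u : noetherian R -> is_ideal J ->
  exists n, forall p x, J (u ^+ p * x) -> J (u ^+ n * x).
Proof.
move=> noeR iJ; pose C n : set R := [set x | J (u ^+ n * x)].
have [_ [n ->] nmax] : exists2 K, (exists n, K = C n) &
    forall L, (exists n, L = C n) -> K `<=` L -> L `<=` K.
  apply: noetherian_max => //; last by exists (C 0%N), 0%N.
  by move=> _ [n ->]; exact: ideal_annihilator.
exists n => p x Jx; apply: (nmax (C (n + p)%N)).
- by exists (n + p)%N.
- by rewrite /C => y /= Jy; rewrite addnC exprD -mulrA; exact: ideal_closedM.
- by rewrite /C /= exprD -mulrA; exact: ideal_closedM.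
Qed.

(** An ideal maximal among those that contain [J] and miss the multiplicative set [S] is prime. *)
Lemma exists_prime_disjoint J (S : set R) : noetherian R -> is_ideal J ->
  S 1 -> (forall x y, S x -> S y -> S (x * y)) -> (forall x, J x -> ~ S x) ->
  exists p : prime_idealr R, J `<=` [set` p] /\ forall x, x \in p -> ~ S x.
Proof.
move=> noeR iJ S1 SM JS.
have [P [iP JP PS] Pmax] : exists2 P,
    [/\ is_ideal P, J `<=` P & forall x, P x -> ~ S x] &
    forall K, [/\ is_ideal K, J `<=` K & forall x, K x -> ~ S x] ->
      P `<=` K -> K `<=` P.
  apply: noetherian_max => //; first by move=> K [].
  by exists J; split=> //; exact: subset_refl.
have meet x : ~ P x -> exists y z, P y /\ S (y + x * z).
  move=> nPx; apply: contrapT => noS; apply: nPx.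
  apply: (Pmax (adjoin P x)); last exact: adjoin_mem.
    split; first exact: adjoin_ideal.
      by move=> y /JP; exact: sub_adjoin.
    by move=> _ [y [z [Py ->]]] Syz; apply: noS; exists y, z.
  exact: sub_adjoin.
have [|x y Pxy|p pP] := exists_prime_idealr iP; first by move=> /PS.
  apply: contrapT => /not_orP[/meet[v [z [Pv Sv]]] /meet[w [t [Pw Sw]]]].
  apply: (PS _ _ (SM _ _ Sv Sw)).
  rewrite (_ : _ * _ = (w + y * t) * v + (x * z) * w + (z * t) * (x * y)); last by ring.
  by do ?[apply: ideal_closedD => //]; exact: ideal_closedM.
exists p; split; first by rewrite pP.
by move=> x xp; apply: PS; rewrite -pP.
Qed.

(* Nakayama's lemma over the localization at P; its proof is the maximality
   argument for ideals saturated with respect to the complement of P. *)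
Lemma local_nakayama P J : noetherian R -> is_ideal P -> ~ P 1 ->
  (forall x y, P (x * y) -> P x \/ P y) -> is_ideal J ->
  (forall x, J x -> exists s, ~ P s /\ ideal_mul P J (s * x)) ->
  forall x, J x -> exists s, ~ P s /\ s * x = 0.
Proof.
move=> noeR iP P1 prP iJ JPJ.
have nPM s t : ~ P s -> ~ P t -> ~ P (s * t) by move=> ? ? /prP[].
pose sat N := forall s x, ~ P s -> N (s * x) -> N x.
apply: contrapT => noS.
(* The kernel of the localization at [P] is a first saturated ideal not containing [J]. *)
pose N0 : set R := [set x | exists s, ~ P s /\ s * x = 0].
have iN0 : is_ideal N0.
  split=> [|a x y [s [Ps sx]] [t [Pt ty]]]; first by exists 1; rewrite mulr0.
  exists (s * t); split; first exact: nPM.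
  rewrite (_ : _ * _ = t * a * (s * x) + s * (t * y)); last by ring.
  by rewrite sx ty !mulr0 addr0.
have [N [iN sN nJN] Nmax] : exists2 N, [/\ is_ideal N, sat N & ~ J `<=` N] &
    forall K, [/\ is_ideal K, sat K & ~ J `<=` K] -> N `<=` K -> K `<=` N.
  apply: noetherian_max => //; first by move=> K [].
  exists N0; split=> // s x Ps [t [Pt /= tx]].
  by exists (t * s); split; [exact: nPM | rewrite -mulrA].
have PJN : ideal_mul P J `<=` N.
  apply: ideal_mul_min => // c y Pc Jy.
  have [/ideal_closedM-/(_ c iN)//|nNy] := pselect (N y).
  (* [N1] is the saturation of [N + P y]. If it contained [y], with [s * y = n + y * e], then
     [s - e], which is outside [P], would multiply [y] into [N]. So [N1] is in [N] by maximality,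
     and [c * y] with it. *)
  pose N1 : set R :=
    [set w | exists s n e, [/\ ~ P s, N n, P e & s * w = n + y * e]].
  apply: (Nmax N1); last 1 first.
  - exists 1, 0, c; split=> //; first exact: ideal_closed0.
    by rewrite mul1r add0r mulrC.
  - split=> [|s w Ps [t [n [e [Pt Nn Pe tw]]]]|/(_ y Jy)]; last 1 first.
    + move=> [s [n [e [Ps Nn Pe sy]]]]; apply: nNy.
      apply: (sN (s - e)) => [Pse|].
        by apply: Ps; rewrite -(subrK e s); exact: ideal_closedD.
      by rewrite mulrBl sy (_ : _ - _ = n) //; ring.
    + split=> [|a w w' [s [n [e [Ps Nn Pe sw]]]] [s' [n' [e' [Ps' Nn' Pe' sw']]]]].
        exists 1, 0, 0; split=> //; [exact: ideal_closed0|exact: ideal_closed0|].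
        by rewrite !mulr0 addr0.
      exists (s * s'), (s' * a * n + s * n'), (s' * a * e + s * e'); split.
      * exact: nPM.
      * by apply: ideal_closedD => //; exact: ideal_closedM.
      * by apply: ideal_closedD => //; exact: ideal_closedM.
      * rewrite (_ : _ * _ = s' * a * (s * w) + s * (s' * w')); last by ring.
        by rewrite sw sw'; ring.
    + by exists (t * s), n, e; split=> //; [exact: nPM | rewrite -mulrA].
  - move=> w Nw; exists 1, w, 0; split=> //; first exact: ideal_closed0.
    by rewrite mul1r mulr0 addr0.
apply: nJN => x /JPJ[s [Ps /PJN]]; exact: sN.
Qed.

End IdealTheory.

(** * Saturation with respect to m, and regular elements *)

Section Saturation.
Variables (R : comNzRingType) (m : set R).
Hypothesis mI : is_ideal m.
Implicit Types (J K : set R) (c u w x y : R).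

(* As m is finitely generated over a noetherian ring, this is J : m^oo. *)
Definition saturation J : set R :=
  [set x | forall u, m u -> exists n, J (u ^+ n * x)].

Lemma sub_saturation J : J `<=` saturation J.
Proof. by move=> x Jx u _; exists 0%N; rewrite expr0 mul1r. Qed.

Lemma saturation_mono J K : J `<=` K -> saturation J `<=` saturation K.
Proof. by move=> JK x Jx u /Jx[n /JK]; exists n. Qed.

Lemma saturation_ideal J : is_ideal J -> is_ideal (saturation J).
Proof.
move=> iJ; split=> [|c x y Jx Jy u mu].
  by apply: sub_saturation; exact: ideal_closed0.
have [n Jn] := Jx _ mu; have [p Jp] := Jy _ mu; exists (n + p)%N.
rewrite exprD (_ : _ * _ = u ^+ p * c * (u ^+ n * x) + u ^+ n * (u ^+ p * y)).
  by apply: ideal_closedD => //; exact: ideal_closedM.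
by ring.
Qed.

Lemma saturation_colon J x :
  (forall u, m u -> saturation J (u * x)) -> saturation J x.
Proof.
move=> Jx u mu; have [n] := Jx u mu u mu.
by rewrite mulrA -exprSr; exists n.+1.
Qed.

Lemma saturation_sub_prime J (p : prime_idealr R) w :
  m w -> w \notin p -> J `<=` [set` p] -> saturation J `<=` [set` p].
Proof.
move=> mw pw Jp x /(_ _ mw)[n /Jp] /=; rewrite prime_idealrM => /orP[|//].
by move=> /prime_mem_pow wp; rewrite wp in pw.
Qed.

(* The maximal annihilators of nonzero elements of R / J are prime, and a new
   one containing [c] can be avoided by adding to [c] an element of all the
   previous ones. The ascending chain condition on [N] ends this process. *)
Lemma exists_regular J : noetherian R -> is_ideal J ->
  (forall x, (forall u, m u -> J (u * x)) -> J x) ->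
  exists2 c, m c & forall x, J (c * x) -> J x.
Proof.
move=> noeR iJ Jm; pose ann x : set R := [set c | J (x * c)].
have iann x : is_ideal (ann x) by exact: ideal_annihilator.
pose maxann x := ~ J x /\ forall y, ~ J y -> ann x `<=` ann y -> ann y `<=` ann x.
have annprime x c e : maxann x -> ann x (c * e) -> ~ ann x c -> ann x e.
  move=> [Jx xmax] xce xc; apply: (xmax (x * c)) => // [f xf|].
    by rewrite /ann /= mulrAC; exact: ideal_closedMr.
  by rewrite /ann /= -mulrA.
(* [N] measures progress: whatever kills [l] modulo [J] also kills [N], so an [x] not killed by some
   such element is outside [N], and adjoining it enlarges [N]. *)
pose F N := is_ideal N /\ exists c (l : seq R), [/\ m c,
  forall x, x \in l -> maxann x /\ ~ ann x c &
  forall e, (forall x, x \in l -> ann x e) -> forall y, N y -> J (y * e)].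
have [N [iN [c [l [mc lmax lN]]]] Nmax] :
    exists2 N, F N & forall K, F K -> N `<=` K -> K `<=` N.
  apply: noetherian_max => //; first by move=> K [].
  exists J; split=> //; exists 0, [::]; split=> //; first exact: ideal_closed0.
  by move=> e _ y Jy; exact: ideal_closedMr.
apply: contrapT => nreg.
have [x0 [Jcx0 nJx0]] : exists x0, J (x0 * c) /\ ~ J x0.
  apply: contrapT => nox; apply: nreg; exists c => // x Jcx.
  by apply: contrapT => nJx; apply: nox; exists x; rewrite mulrC.
have [_ [x [nJx x0x ->]] xmax] :
    exists2 K, exists x, [/\ ~ J x, ann x0 `<=` ann x & K = ann x] &
      forall L, (exists x, [/\ ~ J x, ann x0 `<=` ann x & L = ann x]) ->
        K `<=` L -> L `<=` K.
  apply: noetherian_max => //; first by move=> _ [x [_ _ ->]].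
  by exists (ann x0), x0; split=> //; exact: subset_refl.
have mx : maxann x.
  split=> // y nJy xy; apply: xmax => //; exists y; split=> //.
  exact: subset_trans xy.
have xc : ann x c by exact: x0x.
(* For [y] in [l], maximality of [ann y] keeps it from lying in [ann x], which contains [c]. A
   product of witnesses avoids the prime [ann x]. *)
have [e [le nxe]] : exists e, (forall y, y \in l -> ann y e) /\ ~ ann x e.
  elim: (l) lmax => [|y t IHt] tmax.
    by exists 1; split=> //; rewrite /ann /= mulr1.
  have [z zt|e [te nxe]] := IHt; first by apply: tmax; rewrite inE zt orbT.
  have [ymax nyc] := tmax y (mem_head _ _).
  have [f yf nxf] : exists2 f, ann y f & ~ ann x f.
    apply: contrapT => nof; apply: nyc; apply: (ymax.2 x nJx _ _ xc) => f yf.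
    by apply: contrapT => nxf; apply: nof; exists f.
  exists (e * f); split; last by move=> /annprime -/(_ mx nxe).
  move=> z; rewrite inE => /orP[/eqP -> |/te]; first exact: ideal_closedM.
  exact: ideal_closedMr.
have [b mb nxb] : exists2 b, m b & ~ ann x b.
  apply: contrapT => nob; apply: nJx; apply: Jm => u mu.
  by apply: contrapT => nxu; apply: nob; exists u => //; rewrite /ann /= mulrC.
have nxbe : ~ ann x (b * e) by move=> /annprime -/(_ mx nxb).
apply: (nxe); apply: (lN _ le); apply: (Nmax (adjoin N x)); last 2 first.
- exact: sub_adjoin.
- exact: adjoin_mem.
split; first exact: adjoin_ideal.
exists (c + b * e), (x :: l); split.
- by apply: ideal_closedD => //; exact: ideal_closedMr.
- move=> y; rewrite inE => /orP[/eqP ->|yl].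
    split=> // xcbe; apply: nxbe; apply: (ideal_closedBr (iann x) xcbe).
    by rewrite addrK.
  have [ymax nyc] := lmax y yl; split=> // ycbe; apply: nyc.
  apply: (ideal_closedBr (iann y) ycbe); rewrite (_ : _ - c = b * e); last by ring.
  by apply: ideal_closedM => //; exact: le.
- move=> f lf _ [y [z [Ny ->]]]; rewrite mulrDl; apply: ideal_closedD => //.
    by apply: lN => // w wl; apply: lf; rewrite inE wl orbT.
  by rewrite mulrAC; apply: ideal_closedMr => //; apply: lf; exact: mem_head.
Qed.

End Saturation.

(** * The ideals q_i, their colons by m, and the equality I^2 = Q I *)

Section SocleIdeal.
Variables (R : comNzRingType) (m : set R).
Hypotheses (mI : is_ideal m) (m_local : forall x, m x \/ exists y, y * x = 1).
Variables (a : nat -> R) (k : nat -> nat) (d : nat).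
Implicit Types (i j n : nat) (M : set R) (u v w x y z : R).

(** Of the two factors beyond [a i ^+ k i], one is cancelled in [colon_adjoin] and the other is the
    coefficient in m needed in [colon_max_mul]. [nonprincipal_step] uses that the exponent is at
    least 2. *)
Definition step_pow i := a i ^+ (k i).+2.

Fixpoint step_ideal i : set R :=
  if i is i'.+1 then adjoin (step_ideal i') (step_pow i') else [set 0].

Local Notation b := step_pow.
Local Notation q := step_ideal.
Local Notation V i := (saturation m (q i)).
Local Notation Q := (q d).
Local Notation I := (colon Q m).

Hypothesis a_max : forall i, m (a i).
Hypothesis a_regular : forall i x, V i (a i * x) -> V i x.
Hypothesis a_kill : forall i x, V i x -> q i (a i ^+ k i * x).

Lemma step_ideal_ideal i : is_ideal (q i).
Proof. by elim: i => [|i IHi] /=; [exact: ideal_zero | exact: adjoin_ideal]. Qed.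

Let iq := step_ideal_ideal.
Let iV i : is_ideal (V i). Proof. exact: saturation_ideal. Qed.

Lemma step_ideal_mono i j : (i <= j)%N -> q i `<=` q j.
Proof.
by move=> /subnK <-; elim: (j - i)%N => // n IHn x /IHn; exact: sub_adjoin.
Qed.

Lemma step_pow_mem i j : (i < j)%N -> q j (b i).
Proof. by move=> ij; apply: (step_ideal_mono ij); exact: adjoin_mem. Qed.

Lemma step_ideal_max i : q i `<=` m.
Proof.
elim: i => [x ->|i IHi] /=; first exact: ideal_closed0.
by apply: adjoin_min => //; rewrite /b exprSr; exact: ideal_closedM.
Qed.

Lemma saturation_regular_pow i n x : V i (a i ^+ n * x) -> V i x.
Proof.
elim: n => [|n IHn]; first by rewrite expr0 mul1r.
by rewrite exprS -mulrA => /a_regular.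
Qed.

Lemma saturation_killS i x : V i x -> q i (a i ^+ (k i).+1 * x).
Proof. by move=> /a_kill qx; rewrite exprS -mulrA; exact: ideal_closedM. Qed.

Lemma step_pow_kill i x : V i x -> q i (b i * x).
Proof.
by move=> /a_kill qx; rewrite /b !exprS -!mulrA; do 2!apply: ideal_closedM => //.
Qed.

(** As [a i] is in m, [x * a i] is [b i * y] modulo [M], and cancelling [a i] modulo [V i] yields
    [v]. The ideal [M] will be [q j] in [colon_max_mul] and [q j + V i] in [colon_saturation]. *)
Lemma colon_adjoin i M x : is_ideal M -> q i `<=` M -> M `<=` V i ->
  colon (adjoin M (b i)) m x ->
  exists y v, [/\ x = a i ^+ (k i).+1 * y + v, colon M m v &
    forall u, m u -> exists z, V i (u * y - a i * z)].
Proof.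
move=> iM qM MV cx.
have [w [y [Mw xa]]] := cx _ (a_max i).
have Vv : V i (x - a i ^+ (k i).+1 * y).
  apply: a_regular; apply: MV; rewrite (_ : _ * _ = w) //.
  by rewrite mulrBr [_ * x]mulrC xa /b !exprS; ring.
have div u : m u -> exists w' z, [/\ M w', V i (a i * z - y * u) &
    x * u = w' + b i * z].
  move=> mu; have [w' [z [Mw' xu]]] := cx _ mu; exists w', z; split=> //.
  apply: (@saturation_regular_pow _ (k i).+1).
  rewrite (_ : _ * _ = (x - a i ^+ (k i).+1 * y) * u - w').
    by apply: (ideal_closedB (iV i)); [apply: (ideal_closedMr _ (iV i)) | exact: MV].
  by rewrite mulrBl xu /b !exprS; ring.
exists y, (x - a i ^+ (k i).+1 * y); split; first by ring.
- move=> u mu; have [w' [z [Mw' Vz xu]]] := div u mu.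
  rewrite (_ : _ * _ = w' + a i ^+ (k i).+1 * (a i * z - y * u)).
    by apply: ideal_closedD => //; apply: qM; exact: saturation_killS.
  by rewrite mulrBl xu /b !exprS; ring.
- move=> u mu; have [w' [z [Mw' Vz xu]]] := div u mu; exists z.
  rewrite (_ : _ - _ = 0 - (a i * z - y * u)); last by ring.
  exact: ideal_closedB (iV i) (ideal_closed0 (iV i)) Vz.
Qed.

(** Induction on [j - i]: [colon_adjoin] splits off a multiple of [a j' ^+ (k j').+1], which m
    multiplies into [q j'.+1]; the induction hypothesis applies to the rest. *)
Lemma colon_saturation i j x : (i <= j)%N ->
  (forall u, m u -> exists r v, [/\ q j r, V i v & x * u = r + v]) ->
  exists t v, [/\ colon (q j) m t, V i v & x = t + v].
Proof.
move=> /subnK <-; elim: (j - i)%N x => [|n IHn] x cx.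
  exists 0, x; split; last by rewrite add0r.
    by move=> u _; rewrite mul0r; exact: ideal_closed0.
  apply: saturation_colon => u mu; have [r [v [qr Vv]]] := cx u mu.
  by rewrite mulrC => ->; apply: (ideal_closedD (iV i)) => //; exact: sub_saturation.
set j' := (n + i)%N in IHn *; have ij : (i <= j')%N by exact: leq_addl.
pose M : set R := [set y | exists r v, [/\ q j' r, V i v & y = r + v]].
have Vij : V i `<=` V j' by apply: saturation_mono; exact: step_ideal_mono.
have iM : is_ideal M.
  split=> [|c _ _ [r [v [qr Vv ->]]] [s [w [qs Vw ->]]]].
    exists 0, 0; rewrite addr0; split=> //; first exact: ideal_closed0.
    exact: ideal_closed0 (iV i).
  exists (c * r + s), (c * v + w); split; last by ring.
    by apply: ideal_closedD => //; exact: ideal_closedM.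
  by apply: (ideal_closedD (iV i)) => //; apply: (ideal_closedM _ (iV i)).
have qM : q j' `<=` M.
  by move=> y qy; exists y, 0; rewrite addr0; split=> //; exact: ideal_closed0 (iV i).
have MV : M `<=` V j'.
  move=> _ [r [v [qr Vv ->]]]; apply: (ideal_closedD (iV j')) => //; last exact: Vij.
  exact: sub_saturation.
have [|y [w [-> cw yV]]] := colon_adjoin (x := x) iM qM MV.
  move=> u /cx[r [v [/= [s [z [qs ->]]] Vv ->]]].
  by exists (s + v), z; split; [exists s, v | ring].
have [t [v [ct Vv ->]]] := IHn _ cw.
exists (a j' ^+ (k j').+1 * y + t), v; split=> //; last by rewrite addrA.
move=> u mu; have [z Vz] := yV u mu.
exists (a j' ^+ (k j').+1 * (u * y - a j' * z) + t * u), z.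
rewrite -/(b _) /b; split; last by rewrite !exprS; ring.
by apply: ideal_closedD => //; [exact: saturation_killS | exact: ct].
Qed.

(** If [s + b j' * z] is in [V i], then [z] is in [V j'] by regularity, so [b j'] multiplies it into
    [q j']; this lowers [j] by one. *)
Lemma saturation_step_ideal i j : (i <= j)%N -> V i `&` q j `<=` q i.
Proof.
move=> /subnK <-; elim: (j - i)%N => [|n IHn] x [Vx //].
set j' := (n + i)%N in IHn *; have ij : (i <= j')%N by exact: leq_addl.
move=> /= [s [z [qs xE]]]; apply: IHn; split=> //.
rewrite xE; apply: ideal_closedD => //; apply: step_pow_kill.
apply: (@saturation_regular_pow _ (k j').+2).
rewrite -/(b j') (_ : _ * _ = x - s); last by rewrite xE; ring.
apply: (ideal_closedB (iV j')); last exact: sub_saturation.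
by apply: saturation_mono Vx; exact: step_ideal_mono.
Qed.

(** Descending induction on [i] from [d]: in [x = s + b i * z] with [z] in [Q], regularity puts [z]
    into [V i], hence into [q i] by [saturation_step_ideal]. *)
Lemma square_step_ideal i : (i <= d)%N ->
  ideal_mul Q Q `&` q i `<=` ideal_mul (q i) Q.
Proof.
move=> le_id; have [n nE] : exists n, (d = n + i)%N by exists (d - i)%N; rewrite subnK.
elim: n i nE le_id => [|n IHn] i nE le_id x [QQx qx].
  by rewrite add0n in nE; rewrite -nE.
have lt_id : (i < d)%N by rewrite nE addSn ltnS leq_addl.
have [|//||s [z [qs Qz xE]]] := adjoin_mul (iq i) (iq d) (IHn i.+1 _ _ x _).
- by rewrite nE addSnnS.
- by split=> //; exact: sub_adjoin.
have iqQ := ideal_mul_ideal Q (iq i).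
rewrite xE; apply: ideal_closedD => //; rewrite mulrC.
apply: ideal_mul_mem; last exact: step_pow_mem.
apply: (saturation_step_ideal (ltnW lt_id)); split=> //.
apply: (@saturation_regular_pow _ (k i).+2); apply: sub_saturation.
rewrite -/(b i) (_ : _ * _ = x - s); last by rewrite xE; ring.
apply: ideal_closedB => //.
by move: qs; apply: ideal_mul_min => // y w qy _; exact: ideal_closedMr.
Qed.

Lemma square_socle i x : (i <= d)%N -> q i x ->
  (forall u, m u -> ideal_mul Q Q (x * u)) -> ideal_mul Q I x.
Proof.
have iQI := ideal_mul_ideal I (iq d); have iQQ := ideal_mul_ideal Q (iq d).
elim: i x => [x _ -> _|i IHi x lt_id [s [p [qs xE]]] xm].
  exact: ideal_closed0.
have Qb : Q (b i) by exact: step_pow_mem.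
have [|u mu|t [v [ct Vv pE]]] := colon_saturation (i := i) (j := d) (x := p).
- exact: ltnW.
- have qxu : q i.+1 (x * u).
    by apply: ideal_closedMr => //; exists s, p.
  (* Comparing this expansion of [x * u] along [b i] with the one from [x = s + b i * p] gives
     [p * u - z] in [V i]. *)
  have [r [z [qr Qz xuE]]] :=
    adjoin_mul (iq i) (iq d) (square_step_ideal lt_id (conj (xm u mu) qxu)).
  exists z, (p * u - z); split=> //; last by ring.
  apply: (@saturation_regular_pow _ (k i).+2); apply: sub_saturation.
  rewrite -/(b i) (_ : _ * _ = r - s * u).
    apply: ideal_closedB => //; last exact: ideal_closedMr.
    by move: qr; apply: ideal_mul_min => // y w qy _; exact: ideal_closedMr.
  by rewrite (_ : r = x * u - b i * z); [rewrite xE; ring | rewrite xuE; ring].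
have QIbt : ideal_mul Q I (b i * t) by exact: ideal_mul_mem.
rewrite -(subrK (b i * t) x); apply: ideal_closedD => //.
apply: IHi => [||u mu]; first exact: ltnW.
  rewrite xE pE (_ : _ - _ = s + b i * v); last by ring.
  by apply: ideal_closedD => //; exact: step_pow_kill.
rewrite mulrBl; apply: ideal_closedB => //; first exact: xm.
by rewrite -mulrA; apply: ideal_mul_mem => //; exact: ct.
Qed.

Hypothesis m_nonprincipal : forall i u, (i < d)%N -> m u ->
  (forall w, m w -> exists c, V i (w - c * u)) -> V i 1.

(** By induction only the part [a j ^+ (k j).+1 * y] of [x] matters. Modulo [V j], [u * y] is
    [a j * z], and the product has the required form once [z] is in m. *)
Lemma colon_max_mul j x u : (j <= d)%N -> colon (q j) m x -> m u ->
  ideal_mul m (q j) (x * u).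
Proof.
elim: j x u => [x u _ /(_ u) /= xu /xu ->|j IHj x u lt_jd cx mu].
  exact: ideal_closed0 (ideal_mul_ideal _ mI).
have iqm := ideal_mul_ideal (q j.+1) mI.
have qV : q j `<=` V j by exact: sub_saturation.
have [y [v [-> cv yV]]] := colon_adjoin (iq j) (@subset_refl _ _) qV cx.
have vu : ideal_mul m (q j.+1) (v * u).
  have := IHj v u (ltnW lt_jd) cv mu.
  apply: ideal_mul_min => // w t mw qt; apply: ideal_mul_mem => //.
  exact: sub_adjoin.
rewrite mulrDl; apply: ideal_closedD => //.
have [z [mz Vz]] : exists z, m z /\ V j (u * y - a j * z).
  have [z Vz] := yV u mu; have [mz|[z' zz']] := m_local z; first by exists z.
  (* For a unit [z], eliminating [y] from the congruences for [u] and [w] shows that [u] generates m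
     modulo [V j]. *)
  have V1 : V j 1.
    apply: (m_nonprincipal lt_jd mu) => w mw; have [t Vt] := yV w mw.
    exists (z' * t); apply: a_regular.
    rewrite (_ : _ * _ = z' * (u * (w * y - a j * t) - w * (u * y - a j * z))
                         + a j * w * (1 - z' * z)); last by ring.
    rewrite zz' subrr mulr0 addr0; apply: (ideal_closedM _ (iV j)).
    by apply: (ideal_closedB (iV j)); apply: (ideal_closedM _ (iV j)).
  (* Now [V j] is the whole ring, so [z] may be replaced by 0. *)
  exists 0; split; first exact: ideal_closed0.
  by rewrite -[_ - _]mulr1; apply: (ideal_closedM _ (iV j)).
rewrite (_ : _ * _ = a j * (a j ^+ k j * (u * y - a j * z)) + z * b j).
  apply: ideal_closedD => //; apply: ideal_mul_mem => //.
    by apply: sub_adjoin; exact: a_kill.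
  exact: adjoin_mem.
by rewrite /b !exprS; ring.
Qed.

Hypothesis m_notin : ~ m `<=` Q.

Lemma socle_square : ideal_mul I I `<=` ideal_mul Q I.
Proof.
have iQI := ideal_mul_ideal I (iq d); have iQQ := ideal_mul_ideal Q (iq d).
apply: ideal_mul_min => // x y Ix Iy; apply: (square_socle (leqnn d)) => [|u mu].
  have [mx|[z zx]] := m_local x; first by rewrite mulrC; exact: Iy.
  (* A unit in [Q : m] would put m inside [Q]. *)
  exfalso; apply: m_notin => u mu.
  by rewrite -[u]mul1r -zx -mulrA; apply: ideal_closedM => //; exact: Ix.
rewrite -mulrA.
have : [set w | ideal_mul Q Q (x * w)] (y * u); last by [].
move: (colon_max_mul (leqnn d) Iy mu); apply: ideal_mul_min.
  exact: ideal_annihilator.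
by move=> w t mw Qt; rewrite /= mulrA; apply: ideal_mul_mem => //; exact: Ix.
Qed.

End SocleIdeal.

(** * Local rings: m is not principal modulo V_i, and q_d is primary to m *)

Section LocalRing.
Variables (R : comNzRingType) (m : set R).
Hypotheses (noeR : noetherian R) (mI : is_ideal m) (m1 : ~ m 1).
Hypothesis m_local : forall x, m x \/ exists y, y * x = 1.
Implicit Types (i j n : nat) (J V : set R) (u v w x y z : R).

Lemma proper_sub_max J : is_ideal J -> ~ J 1 -> J `<=` m.
Proof.
move=> iJ J1 x Jx; have [//|[y yx]] := m_local x.
by exfalso; apply: J1; rewrite -yx; exact: ideal_closedM.
Qed.

Lemma prime_sub_max (p : prime_idealr R) : [set` p] `<=` m.
Proof. by apply: proper_sub_max; [exact: ideal_mem | rewrite /= idealr1]. Qed.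

Lemma max_prime x y : m (x * y) -> m x \/ m y.
Proof.
move=> mxy; have [mx|[z zx]] := m_local x; [by left | right].
by rewrite -[y]mul1r -zx -mulrA; exact: ideal_closedM.
Qed.

Lemma max_prime_pow n x : m (x ^+ n) -> m x.
Proof.
by elim: n => [|n IHn]; [rewrite expr0 | rewrite exprS => /max_prime[|/IHn]].
Qed.

Lemma nakayama J : is_ideal J -> J `<=` ideal_mul m J -> J `<=` [set 0].
Proof.
move=> iJ Jm x Jx.
have [y Jy|s [ms sx]] := @local_nakayama _ _ _ noeR mI m1 max_prime iJ _ x Jx.
  by exists 1; rewrite mul1r; split; [exact: m1 | exact: Jm].
have [//|[t ts]] := m_local s.
by rewrite /= -[x]mul1r -ts -mulrA sx mulr0.
Qed.

Section PrincipalModulo.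
Variables (V : set R) (u : R).
Hypotheses (iV : is_ideal V) (V1 : ~ V 1) (mu : m u).
Hypothesis V_colon : forall x, (forall w, m w -> V (w * x)) -> V x.
Hypothesis mV : forall w, m w -> exists c, V (w - c * u).

(* R / V is a discrete valuation ring with uniformizer u. *)
Lemma dvr_dvd_pow x : ~ V x -> exists n c, V (u ^+ n - c * x).
Proof.
move=> nVx.
(* Dividing a nonunit [y] by [u] once more strictly enlarges [adjoin V y], so at a maximal one [y]
   is a unit. *)
pose F J := exists y n, [/\ ~ V y, V (x - u ^+ n * y) & J = adjoin V y].
have [_ [y [n [nVy Vxy ->]]] ymax] :
    exists2 J, F J & forall K, F K -> J `<=` K -> K `<=` J.
  apply: noetherian_max => //; first by move=> _ [y [n [_ _ ->]]]; exact: adjoin_ideal.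
  exists (adjoin V x), x, 0%N; split=> //.
  by rewrite expr0 mul1r subrr; exact: ideal_closed0.
have [my|[z zy]] := m_local y; last first.
  exists n, z; rewrite (_ : _ - _ = (0 - z) * (x - u ^+ n * y) + u ^+ n * (1 - z * y)).
    by rewrite zy subrr mulr0 addr0; exact: ideal_closedM.
  by ring.
have [c Vyc] := mV my; exfalso.
have nVc : ~ V c.
  move=> Vc; apply: nVy; rewrite -(subrK (c * u) y).
  by apply: ideal_closedD => //; exact: ideal_closedMr.
have [||v [t [Vv cE]]] := ymax (adjoin V c) _ _ c (adjoin_mem c iV).
- exists c, n.+1; split=> //.
  rewrite (_ : _ - _ = (x - u ^+ n * y) + u ^+ n * (y - c * u)).
    by apply: ideal_closedD => //; exact: ideal_closedM.
  by rewrite exprS; ring.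
- apply: adjoin_min; [exact: adjoin_ideal | exact: sub_adjoin |].
  by exists (y - c * u), u; split=> //; ring.
have V1ut : V ((1 - u * t) * c).
  have -> : (1 - u * t) * c = v + (y - c * u) * t.
    by rewrite mulrBl mul1r {1}cE; ring.
  by apply: ideal_closedD => //; exact: ideal_closedMr.
have [mut|[s sut]] := m_local (1 - u * t).
  by apply: m1; rewrite -(subrK (u * t) 1); apply: ideal_closedD => //;
    exact: ideal_closedMr.
by apply: nVc; rewrite -[c]mul1r -sut -mulrA; exact: ideal_closedM.
Qed.

(** What [u] kills modulo [V] is killed by all of m, hence lies in [V]. *)
Lemma dvr_regular n x : V (u ^+ n * x) -> V x.
Proof.
elim: n x => [|n IHn] x; first by rewrite expr0 mul1r.
rewrite exprSr -mulrA => /IHn Vux; apply: V_colon => w mw.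
have [c Vc] := mV mw.
rewrite (_ : w * x = (w - c * u) * x + c * (u * x)); last by ring.
by apply: ideal_closedD => //; [exact: ideal_closedMr | exact: ideal_closedM].
Qed.

(** Elements outside [V] divide powers of [u] modulo [V], so if their product were in [V], a power
    of [u] would be too. *)
Lemma dvr_prime x y : V (x * y) -> V x \/ V y.
Proof.
move=> Vxy; apply: contrapT => /not_orP[/dvr_dvd_pow[n [c Vx]] /dvr_dvd_pow[p [e Vy]]].
apply: V1; apply: (@dvr_regular (n + p)%N); rewrite mulr1 exprD.
rewrite (_ : _ * _ = u ^+ p * (u ^+ n - c * x) + c * x * (u ^+ p - e * y)
                     + c * e * (x * y)); last by ring.
by apply: (ideal_closedD iV); [apply: (ideal_closedD iV)|]; exact: ideal_closedM.
Qed.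

Lemma dvr_prime_pow n x : V (x ^+ n) -> V x.
Proof.
by elim: n => [|n IHn]; [rewrite expr0 | rewrite exprS => /dvr_prime[|/IHn]].
Qed.

End PrincipalModulo.

Section Steps.
Variables (a : nat -> R) (k : nat -> nat).
Local Notation q := (step_ideal a k).
Local Notation b := (step_pow a k).
Local Notation V i := (saturation m (q i)).
Hypothesis a_regular : forall i x, V i (a i * x) -> V i x.

(* If m = (u) + V i, then V i is prime and contains the [a j], so that
   q i <= (V i)^2; hence V i vanishes locally at V i, and [a 0], which kills
   no element outside V i, can only belong to V i if that ideal is R. *)
Lemma nonprincipal_step i u : m u ->
  (forall w, m w -> exists c, V i.+1 (w - c * u)) -> V i.+1 1.
Proof.
move=> mu mV; apply: contrapT => V1.
have iq := step_ideal_ideal a k.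
have iV : is_ideal (V i.+1) by exact: saturation_ideal.
have V_colon x : (forall w, m w -> V i.+1 (w * x)) -> V i.+1 x.
  exact: saturation_colon.
have Vprime := dvr_prime iV V1 mu V_colon mV.
have Va j : (j <= i)%N -> V i.+1 (a j).
  move=> ji; apply: (dvr_prime_pow iV V1 mu V_colon mV (n := (k j).+2)).
  by apply: sub_saturation; exact: step_pow_mem.
have iVV := ideal_mul_ideal (V i.+1) iV.
have qVV j : (j <= i.+1)%N -> q j `<=` ideal_mul (V i.+1) (V i.+1).
  elim: j => [_ _ ->|j IHj lt_ji]; first exact: ideal_closed0.
  rewrite -[q j.+1]/(adjoin (q j) (b j)).
  apply: adjoin_min => //; first exact: IHj (ltnW lt_ji).
  rewrite /step_pow exprS; apply: ideal_mul_mem; first exact: Va.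
  by rewrite exprSr; apply: (ideal_closedM _ iV); exact: Va.
(* [u ^+ n] is outside the prime [V i.+1] and multiplies it into [q i.+1], so it is the multiplier
   [local_nakayama] asks for. *)
have [n nV] := noetherian_pow_colon u noeR (iq i.+1).
have [x Vx|s [nVs sa]] :=
    @local_nakayama _ _ _ noeR iV V1 Vprime iV _ (a 0%N) (Va 0%N isT).
  exists (u ^+ n); split.
    by move=> Vu; apply: V1; apply: (dvr_regular iV V_colon mV (n := n)); rewrite mulr1.
  by apply: (qVV i.+1) => //; have [p /nV] := Vx u mu.
apply: nVs; have : V 0%N s.
  by apply: a_regular; rewrite mulrC sa; exact: sub_saturation.
by apply: saturation_mono; exact: step_ideal_mono.
Qed.

(** An element of [c 1] outside [c 0] divides a power of [u] modulo [V 0], which lies in [c 0]. So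
    [c 1] contains [u], hence m, leaving no room for [c 2]. *)
Lemma nonprincipal_zero (c : nat -> prime_idealr R) u : prime_chain 2 c -> m u ->
  (forall w, m w -> exists c, V 0%N (w - c * u)) -> V 0%N 1.
Proof.
move=> cc mu mV; apply: contrapT => V1; exfalso.
have [c01 c12] := (cc 0%N isT, cc 1%N isT).
have iV : is_ideal (V 0%N) by apply: saturation_ideal => //; exact: ideal_zero.
have /existsNP[y /not_implyP[c1y c0y]] := c01.2.
have /existsNP[z /not_implyP[c2z c1z]] := c12.2.
have V0 : V 0%N `<=` [set` c 0%N].
  apply: (saturation_sub_prime (w := y)).
  - exact: prime_sub_max c1y.
  - exact/negP.
  - by move=> _ ->; exact: idealr0.
have nVy : ~ V 0%N y by move=> /V0.
have [n [e Vn]] := dvr_dvd_pow iV mu mV nVy.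
have c1u : u \in c 1%N.
  apply: (@prime_mem_pow _ _ _ n); rewrite -(subrK (e * y) (u ^+ n)).
  by apply: rpredD; [exact: c01.1 (V0 _ Vn) | exact: idealMr].
have [f Vz] := mV z (prime_sub_max c2z).
apply: c1z; rewrite /= -(subrK (f * u) z).
by apply: rpredD; [exact: c01.1 (V0 _ Vz) | exact: idealMr].
Qed.

(** As [a i] is regular modulo [V i], which lies in [p], no power of [a i] times an element outside
    [p] is in [q i]. So a prime over [q i] inside [p] misses [a i], and is strictly smaller since
    [p] contains [a i]. *)
Lemma prime_chain_below i (p : prime_idealr R) w : m w -> w \notin p ->
  q i `<=` [set` p] ->
  exists c : nat -> prime_idealr R, prime_chain i c /\ c i = p.
Proof.
elim: i p => [|i IHi] p mw pw qp; first by exists (fun=> p).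
have qip : q i `<=` [set` p] by move=> x qx; apply: qp; exact: sub_adjoin.
have Vp := saturation_sub_prime mw pw qip.
have pa : a i \in p.
  apply: (@prime_mem_pow _ _ _ (k i).+2).
  by apply: qp; apply: adjoin_mem; exact: step_ideal_ideal.
have [|||x qx [n [s [ps xE]]]|p' [qp' p'S]] := @exists_prime_disjoint _ (q i)
    [set x | exists n s, s \notin p /\ x = a i ^+ n * s] noeR.
- exact: step_ideal_ideal.
- by exists 0%N, 1; rewrite idealr1 expr0 mul1r.
- move=> _ _ [n [s [ps ->]]] [n' [s' [ps' ->]]]; exists (n + n')%N, (s * s').
  by rewrite prime_idealrM negb_or ps ps' exprD; split=> //; ring.
- move/negP: ps; apply; apply: Vp; apply: (saturation_regular_pow a_regular (n := n)).
  by apply: sub_saturation; rewrite -xE.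
have p'p : [set` p'] `<=` [set` p].
  move=> x /= xp'; apply: contrapT => /negP xp; apply: (p'S x xp').
  by exists 0%N, x; rewrite expr0 mul1r.
have p'a : a i \notin p'.
  apply/negP => /p'S; apply; exists 1%N, 1.
  by rewrite idealr1 expr1 mulr1.
have [|c [cc ci]] := IHi p' mw _ qp'; first by apply: contra pw => /p'p.
exists (fun j => if (j <= i)%N then c j else p); split; last by rewrite ltnn.
move=> j; rewrite ltnS => ji; rewrite ji; case: ltnP => [/cc //|ij].
have -> : j = i by apply/eqP; rewrite eqn_leq ji ij.
by rewrite ci; split=> // pp'; move/negP: p'a; apply; exact: pp'.
Qed.

(** A prime over [q d] missing [u] would top a chain of length [d], and m above it would make the
    chain too long. *)
Lemma step_ideal_primary d u :
  (forall n (c : nat -> prime_idealr R), prime_chain n c -> (n <= d)%N) ->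
  m u -> exists n, q d (u ^+ n).
Proof.
move=> dimR mu; apply: contrapT => nq.
have [|||x qx [n xE]|p [qp pS]] := @exists_prime_disjoint _ (q d)
    [set x | exists n, x = u ^+ n] noeR.
- exact: step_ideal_ideal.
- by exists 0%N.
- by move=> _ _ [n ->] [p ->]; exists (n + p)%N; rewrite exprD.
- by apply: nq; exists n; rewrite -xE.
have pu : u \notin p by apply/negP => /pS; apply; exists 1%N.
have [c [cc cd]] := prime_chain_below mu pu qp.
have [M mE] := exists_prime_idealr mI m1 max_prime.
suff /dimR : prime_chain d.+1 (fun j => if (j <= d)%N then c j else M).
  by rewrite ltnn.
move=> j; rewrite ltnS => jd; rewrite jd; case: ltnP => [/cc //|dj].
have -> : j = d by apply/eqP; rewrite eqn_leq jd dj.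
rewrite cd mE; split; first exact: prime_sub_max.
by move=> /(_ u mu); move/negP: pu.
Qed.

End Steps.

Lemma exists_steps (E : set R) : is_ideal E ->
  (forall u, m u -> exists n, E (u ^+ n)) ->
  exists a k, [/\ forall i, m (a i), forall i, E (step_pow a k i),
    forall i x, saturation m (step_ideal a k i) (a i * x) ->
      saturation m (step_ideal a k i) x &
    forall i x, saturation m (step_ideal a k i) x ->
      step_ideal a k i (a i ^+ k i * x)].
Proof.
move=> iE mE.
(* The next pair depends only on the ideal built so far, so plain choice suffices; off the ideals
   the pair is a dummy. *)
have step J : exists ck : R * nat, is_ideal J ->
    [/\ m ck.1, E (ck.1 ^+ ck.2.+2),
      forall x, saturation m J (ck.1 * x) -> saturation m J x &
      forall x, saturation m J x -> J (ck.1 ^+ ck.2 * x)].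
  have [iJ|nJ] := pselect (is_ideal J); last by exists (0, 0%N).
  have [|c mc creg] := exists_regular mI noeR (saturation_ideal m iJ).
    by move=> x; exact: saturation_colon.
  have [n nJ] := noetherian_pow_colon c noeR iJ; have [p Ep] := mE c mc.
  (* The summand [n] sends the saturation into [J]; [p] puts the power into [E]. *)
  exists (c, (p + n)%N) => _; split=> //= [|x /(_ c mc)[e /nJ Jx]].
    by rewrite -!addnS exprD; exact: ideal_closedMr.
  by rewrite exprD -mulrA; exact: ideal_closedM.
have [f fP] := choice step.
pose q n := iter n (fun J => adjoin J ((f J).1 ^+ (f J).2.+2)) [set 0].
exists (fun i => (f (q i)).1), (fun i => (f (q i)).2).
have qE i : step_ideal (fun i => (f (q i)).1) (fun i => (f (q i)).2) i = q i.
  by elim: i => //= i ->.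
have iq i : is_ideal (q i) by rewrite -qE; exact: step_ideal_ideal.
by split=> i; rewrite ?qE; have [] := fP _ (iq i).
Qed.

Lemma step_ideal_span (a : nat -> R) (k : nat -> nat) d :
  step_ideal a k d = ideal_span (mkseq (step_pow a k) d).
Proof.
apply/seteqP; split; last first.
  apply: ideal_span_min; first exact: step_ideal_ideal.
  by move=> x /mapP[i]; rewrite mem_iota => /andP[_ id] ->; exact: step_pow_mem.
have iS := ideal_span_ideal (mkseq (step_pow a k) d).
(* The induction runs over [i <= d], with the list of all [d] generators fixed. *)
have : (d <= d)%N by []; elim: {1 3}d => [_ _ ->|i IHi lt_id].
  exact: ideal_closed0.
apply: adjoin_min => //; first exact: IHi (ltnW lt_id).
by apply: ideal_span_mem; apply: map_f; rewrite mem_iota.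
Qed.

End LocalRing.

(** * Existence of good parameter ideals inside a given m-primary ideal *)

Section ParameterIdeals.
Variables (A : comNzRingType) (m : idealr A) (d : nat).
Hypotheses (noeA : noetherian A) (localA : local_ring m).
Hypotheses (dimA : krull_dim_eq A d) (d_ge2 : (2 <= d)%N).

Definition good_parameter_ideal (Q : set A) := parameter_ideal m Q /\
  let I := colon Q [set` m] in ideal_pow I 2 = ideal_mul Q I.

(** A nonunit lies in a maximal ideal, which locality identifies with m. *)
Lemma local_ring_unit x : [set` m] x \/ exists y, y * x = 1.
Proof.
apply: contrapT => /not_orP[nmx nux].
pose J0 := adjoin [set 0] x; have iJ0 := adjoin_ideal x (@ideal_zero A).
have [J [iJ J0J J1] Jmax] : exists2 J, [/\ is_ideal J, J0 `<=` J & ~ J 1] &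
    forall K, [/\ is_ideal K, J0 `<=` K & ~ K 1] -> J `<=` K -> K `<=` J.
  apply: noetherian_max => //; first by move=> K [].
  exists J0; split=> //.
  by move=> [_ [y [-> xy]]]; apply: nux; exists y; rewrite xy add0r mulrC.
have [M ME] := exists_idealr iJ J1.
apply: nmx; rewrite -(localA.2 M) ?ME.
  by apply: J0J; apply: adjoin_mem; exact: ideal_zero.
move=> K iK; rewrite ME => JK; have [K1|K1] := pselect (K 1).
  right; apply/seteqP; split=> // y _.
  by rewrite -[y]mulr1; exact: ideal_closedM.
left; apply/seteqP; split=> //; apply: Jmax => //; split=> //.
exact: subset_trans JK.
Qed.

Let iM : is_ideal [set` m]. Proof. exact: ideal_mem. Qed.
Let M1 : ~ [set` m] 1. Proof. by rewrite /= idealr1. Qed.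

Lemma max_ideal_not_nil : ~ (forall u, u \in m -> exists n, u ^+ n = 0).
Proof.
have [[c cc] _] := dimA; move=> nil.
have /existsNP[x /not_implyP[c1x c0x]] := (cc 0%N (ltnW d_ge2)).2.
have [n xn0] := nil x (prime_sub_max local_ring_unit c1x).
by apply: c0x; apply: (@prime_mem_pow _ _ _ n); rewrite xn0 idealr0.
Qed.

Lemma max_ideal_neq_square : ~ [set` m] `<=` ideal_mul [set` m] [set` m].
Proof.
move=> mm; apply: max_ideal_not_nil => u mu; exists 1%N; rewrite expr1.
exact: (nakayama noeA iM M1 local_ring_unit iM mm).
Qed.

Lemma exists_good_parameter_ideal (E : set A) : is_ideal E ->
  (forall u, u \in m -> exists n, E (u ^+ n)) -> ~ [set` m] `<=` E ->
  exists Q, good_parameter_ideal Q /\ Q `<=` E.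
Proof.
move=> iE mE nmE.
have [a [k [a_max Eb a_reg a_kill]]] := exists_steps noeA iM iE mE.
pose q := step_ideal a k; have iq : forall i, is_ideal (q i) by exact: step_ideal_ideal.
have QE : q d `<=` E.
  rewrite /q step_ideal_span; apply: ideal_span_min => //.
  by move=> x /mapP[i _ ->].
have qm : q d `<=` [set` m] by exact: step_ideal_max.
have primQ u : u \in m -> exists n, q d (u ^+ n).
  by apply: (step_ideal_primary noeA iM M1 local_ring_unit a_reg); exact: dimA.2.
have m_nonprincipal i u : (i < d)%N -> [set` m] u ->
    (forall w, [set` m] w -> exists c, saturation [set` m] (q i) (w - c * u)) ->
    saturation [set` m] (q i) 1.
  case: i => [_|i _].
    have [[c cc] _] := dimA.
    apply: (nonprincipal_zero noeA iM M1 local_ring_unit (c := c)) => //.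
    by move=> j j2; apply: cc; exact: leq_trans d_ge2.
  exact: (nonprincipal_step noeA iM M1 local_ring_unit a_reg).
have nmQ : ~ [set` m] `<=` q d by move=> /subset_trans/(_ QE).
have IQI := socle_square iM local_ring_unit a_max a_reg a_kill m_nonprincipal nmQ.
exists (q d); split=> //; split.
  exists d, [tuple of mkseq (step_pow a k) d].
  rewrite -(step_ideal_span a k d) -/q; split=> //.
    split=> //; first by move=> /qm.
    move=> x y Qxy; have [/primQ my|[z zy]] := local_ring_unit y; first by right.
    by left; rewrite -[x]mul1r -zy mulrAC -mulrA; exact: ideal_closedM.
  apply/seteqP; split=> [x [n /qm]|x /primQ //].
  exact: (max_prime_pow iM M1 local_ring_unit).
have iI : is_ideal (colon (q d) [set` m]) by exact: ideal_colon.
(* [ideal_pow I 2] unfolds to I (I R), so I R has to be identified with I. *)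
apply/seteqP; split=> x /=.
  rewrite (_ : ideal_mul (colon (q d) [set` m]) setT = colon (q d) [set` m]).
    exact: IQI.
  apply/seteqP; split=> [y|y Iy].
    by apply: ideal_mul_min => // z w Iz _; apply: (ideal_closedMr _ iI).
  by rewrite -[y]mulr1; exact: ideal_mul_mem.
apply: ideal_mul_min; first exact: ideal_mul_ideal.
move=> y z Qy Iz; apply: ideal_mul_mem; first by move=> u _; apply: (ideal_closedMr _ (iq d)).
by rewrite -[z]mulr1; exact: ideal_mul_mem.
Qed.

(** Take [E] to be m Q. It does not contain m, being inside m^2; and it differs from [Q], since
    otherwise Nakayama would give [Q = 0] and m would be nil. *)
Lemma exists_smaller_good_parameter_ideal (Q : set A) : good_parameter_ideal Q ->
  exists Q', good_parameter_ideal Q' /\ Q' `<` Q.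
Proof.
move=> [[e [x [_ [iQ _ _] radQ QE]]] _]; rewrite -QE in iQ radQ.
have mQ u : u \in m -> exists n, Q (u ^+ n).
  by move=> mu; have : radical Q u by rewrite radQ.
have Qm : Q `<=` [set` m] by move=> y Qy; rewrite -radQ; exists 1%N; rewrite expr1.
have nak := nakayama noeA iM M1 local_ring_unit.
have [|u mu|mmQ|Q' [gQ' Q'mQ]] := @exists_good_parameter_ideal (ideal_mul [set` m] Q).
- exact: ideal_mul_ideal.
- have [n Qu] := mQ u mu; exists n.+1; rewrite exprS; exact: ideal_mul_mem.
- apply: max_ideal_neq_square => y /mmQ; apply: ideal_mul_min; first exact: ideal_mul_ideal.
  by move=> z w mz Qw; apply: ideal_mul_mem => //; exact: Qm.
exists Q'; split=> //; split.
  apply: subset_trans Q'mQ _; apply: ideal_mul_min => // y z _ Qz.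
  exact: ideal_closedM.
move=> QQ'; have Q0 := nak _ iQ (subset_trans QQ' Q'mQ).
by apply: max_ideal_not_nil => u /mQ[n /Q0]; exists n.
Qed.

End ParameterIdeals.

(** * Infinitude by strict descent *)

Lemma infinite_set_descending (T : Type) (S : set (set T)) : S !=set0 ->
  (forall X, S X -> exists Y, S Y /\ Y `<` X) -> infinite_set S.
Proof.
move=> [X0 SX0] desc.
have step X : exists Y, S X -> S Y /\ Y `<` X.
  by have [/desc[Y]|nSX] := pselect (S X); [exists Y | exists X].
have [f fP] := choice step.
pose F n := iter n f X0.
have SF n : S (F n) by elim: n => //= n /fP[].
have Fmono n p : F (n + p)%N `<=` F p.
  elim: n => //= n IHn; apply: subset_trans IHn.
  by have [_ []] := fP _ (SF (n + p)%N).
have Flt n p : (n < p)%N -> F n <> F p.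
  move=> np Fnp; have [_ [_]] := fP _ (SF n); apply.
  suff : F p `<=` F n.+1 by rewrite -Fnp.
  by rewrite -(subnK np); exact: Fmono.
apply/infiniteP; have Finj : {in [set: nat] &, injective F}.
  move=> n p _ _ Fnp; apply/eqP; case: ltngtP => // /Flt; first by move/(_ Fnp).
  by move/(_ (esym Fnp)).
have FS : F @` setT `<=` S by move=> _ [n _ <-].
apply: card_le_trans (subset_card_le FS).
by have := inj_card_eq Finj; rewrite card_eq_le => /andP[].
Qed.

Theorem mainTheorem3 (A : comNzRingType) (m : idealr A) (d : nat)
    (A_noetherian : noetherian A) (A_local : local_ring m)
    (dimA : krull_dim_eq A d) (d_ge2 : (2 <= d)%N) (A_unmixed : unmixed m d) :
  infinite_set [set Q : set A | parameter_ideal m Q /\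
    let I := colon Q [set` m] in ideal_pow I 2 = ideal_mul Q I].
Proof.
have iM := ideal_mem m.
apply: infinite_set_descending; last first.
  exact: (exists_smaller_good_parameter_ideal A_noetherian A_local dimA d_ge2).
(* The descent starts inside m^2, which does not contain m. *)
have [|u mu||Q [gQ _]] := exists_good_parameter_ideal A_noetherian A_local dimA d_ge2
  (E := ideal_mul [set` m] [set` m]).
- exact: ideal_mul_ideal.
- by exists 2%N; exact: ideal_mul_mem.
- exact: (max_ideal_neq_square A_noetherian A_local dimA d_ge2).
- by exists Q.
Qed.
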